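(* Let $p$ be an odd prime, let $q\in\mathbb{C}_p$ with $|1-q|_p<p^{-\frac{1}{p-1}}$, and let $x\in\mathbb{Z}_p$. For every integer $n\ge0$, \[ Ch_{n,q}(x)=\sum_{k=0}^n\sum_{l=0}^k\binom{k}{l}S_1(n,k)[x]_q^{k-l}q^{lx}\mathcal{E}_{l,q}. \]
   Context: For $x\in\mathbb{Z}_p$, $[x]_q=\frac{q^x-1}{q-1}$. The fermionic $p$-adic $q$-integral of a continuous $f:\mathbb{Z}_p\to\mathbb{C}_p$ is $\int_{\mathbb{Z}_p}f(y)\,d\mu_{-q}(y)=\lim_{N\to\infty}\frac{1}{[p^N]_{-q}}\sum_{y=0}^{p^N-1}f(y)(-q)^y$, where $[m]_{-q}=\frac{1-(-q)^m}{1+q}$. The Carlitz $q$-Euler numbers are $\mathcal{E}_{l,q}=\int_{\mathbb{Z}_p}[y]_q^l\,d\mu_{-q}(y)$. The Carlitz-type $q$-Changhee polynomials $Ch_{n,q}(x)$ are defined by $\int_{\mathbb{Z}_p}(1+t)^{[x+y]_q}\,d\mu_{-q}(y)=\sum_{n\ge0}Ch_{n,q}(x)\frac{t^n}{n!}$ for $t\in\mathbb{C}_p$ with $|t|_p<p^{-\frac{1}{p-1}}$. $S_1(n,k)$ are the (signed) Stirling numbers of the first kind, $x(x-1)\cdots(x-n+1)=\sum_{k=0}^nS_1(n,k)x^k$. *)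

(* Defs.v *)
From mathcomp Require Import all_boot all_order all_algebra.
From mathcomp Require Import all_classical all_reals all_analysis.

Set Implicit Arguments.
Unset Strict Implicit.
Unset Printing Implicit Defensive.

Import Order.TTheory GRing.Theory Num.Theory.
Import numFieldNormedType.Exports.
Local Open Scope classical_set_scope.
Local Open Scope ring_scope.

Section ValuedField.
Variables (R : realType) (K : closedFieldType) (abs : K -> R).

Definition abs_cvg (u : nat -> K) (l : K) : Prop :=
  (fun n => abs (u n - l)) @ \oo --> (0 : R).

Definition abs_cauchy (u : nat -> K) : Prop :=
  forall e : R, 0 < e ->
    \forall N \near \oo, forall m n, (N <= m)%N -> (N <= n)%N ->
      abs (u m - u n) < e.

Definition abs_closure (A : set K) : set K :=
  [set x | forall e : R, 0 < e -> exists2 a, A a & abs (x - a) < e].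

(* When K is complete and abs restricts to the p-adic absolute value on Q, this
   is the copy of Q_p in K. *)
Definition closure_rat : set K := abs_closure (range (ratr : rat -> K)).

Definition algebraic_over (F : set K) (z : K) : Prop :=
  exists P : {poly K}, [/\ P != 0, forall i, F P`_i & root P z].

End ValuedField.

(* C_p, up to isometric isomorphism: a complete, algebraically closed field
   extending (Q_p, |.|_p) in which the algebraic closure of Q_p is dense. The
   absolute value is a separate field because MathComp's normed structures
   require `|x *+ n| = `|x| *+ n, which no p-adic absolute value satisfies. *)
Record CpType (R : realType) (p : nat) := {
  Cp_sort :> closedFieldType ;
  padic_abs : Cp_sort -> R ;
  padic_abs_ge0 : forall x, 0 <= padic_abs x ;
  padic_abs_eq0 : forall x, padic_abs x = 0 <-> x = 0 ;
  padic_absM : forall x y, padic_abs (x * y) = padic_abs x * padic_abs y ;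
  padic_absD : forall x y,
    padic_abs (x + y) <= Num.max (padic_abs x) (padic_abs y) ;
  (* normalization; for p prime it determines padic_abs on the rationals *)
  padic_abs_p : padic_abs p%:R = p%:R^-1 ;
  padic_complete : forall u, abs_cauchy padic_abs u ->
    exists l, abs_cvg padic_abs u l ;
  padic_dense_algebraic :
    abs_closure padic_abs (algebraic_over (closure_rat padic_abs)) = setT
}.

Section Defs.
Variables (R : realType) (p : nat) (K : CpType R p).
Implicit Types (q t x a z : K) (f : K -> K).

(* Q_p inside C_p, and Z_p as its valuation ring *)
Definition padic_num : set K := closure_rat (@padic_abs R p K).

Definition padic_int : set K := [set x | padic_num x /\ padic_abs x <= 1].

(* 0 if u diverges; limits are unique. *)
Definition padic_lim (u : nat -> K) : K :=
  xget 0 [set l | abs_cvg (@padic_abs R p K) u l].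

Definition exp_radius : R := p%:R `^ (- p.-1%:R^-1).

Definition padic_exp z : K := padic_lim (series (fun n => z ^+ n / n`!%:R)).

Definition padic_log a : K :=
  padic_lim (series (fun n => (-1) ^+ n * (a - 1) ^+ n.+1 / n.+1%:R)).

(* a^z = exp(z log a), meant for |a - 1| < p^(-1/(p-1)) and |z| <= 1, where both
   series converge. *)
Definition padic_pow a z : K := padic_exp (z * padic_log a).

(* [x]_q; at q = 1 the quotient is read as its limit x. *)
Definition qnum q x : K :=
  if q == 1 then x else (padic_pow q x - 1) / (q - 1).

(* [m]_{-q} for a natural number m *)
Definition qnumN q (m : nat) : K := (1 - (- q) ^+ m) / (1 + q).

(* The integral over Z_p of f against mu_{-q}; only the values of f on the
   natural numbers, a dense subset of Z_p, enter. *)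
Definition fermionic_integral q f : K :=
  padic_lim (fun N => (qnumN q (p ^ N))^-1 *
                      \sum_(y < p ^ N) f (y : nat)%:R * (- q) ^+ y).

Definition carlitz_euler q (l : nat) : K :=
  fermionic_integral q (fun y => qnum q y ^+ l).

Definition is_changhee q x (c : nat -> K) : Prop :=
  forall t, padic_abs t < exp_radius ->
    abs_cvg (@padic_abs R p K)
      (series (fun n => c n * (t ^+ n / n`!%:R)))
      (fermionic_integral q (fun y => padic_pow (1 + t) (qnum q (x + y)))).

(* The sequence of coefficients satisfying the generating identity (and the
   zero sequence if there were none). *)
Definition changhee q x : nat -> K :=
  xget (fun=> 0) [set c | is_changhee q x c].

End Defs.

(* Signed Stirling numbers of the first kind, as the coefficients of
   X(X - 1)...(X - n + 1). *)
Definition stirling1 (n k : nat) : int :=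
  (\prod_(i < n) ('X - (i%:Z)%:P) : {poly int})`_k.

(* Main.v *)
(* Put I_N(f) for the N-th average defining the fermionic integral, and
   E_m = int [x+y]_q^m.  As p is odd, |[p^N]_{-q}| = 1, so |I_N(f)| <= sup |f|,
   and I_N(f) converges as soon as |f(y+h) - f(y)| <= |h|, which holds for the
   powers of [x+y]_q.  Expanding [x+y]_q = [x]_q + q^x [y]_q gives E_m in terms
   of the Carlitz numbers.  With L = log(1+t), dominated convergence in
   exp([x+y]_q L) = sum_m [x+y]_q^m L^m/m! shows that the generating function is
   sum_m E_m L^m/m!; substituting L^m/m! = sum_n S_1(n,m) t^n/n! and exchanging
   the two sums yields the coefficients, which are determined by the values of
   the series on the disc.  The identity exp(log q) = q is never needed: q^y only
   enters through q^(x+y) = q^x q^y and |q^x - 1| <= |x| |1 - q|. *)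
Require Import Defs.
From mathcomp Require Import all_boot all_order all_algebra.
From mathcomp Require Import all_classical all_reals all_analysis.
From mathcomp Require Import ring lra.

Set Implicit Arguments.
Unset Strict Implicit.
Unset Printing Implicit Defensive.

Import Order.TTheory GRing.Theory Num.Theory.
Import numFieldNormedType.Exports.
Local Open Scope classical_set_scope.
Local Open Scope ring_scope.

(** * Ultrametric limits and series in C_p *)

Section Valuation.
Variables (R : realType) (p : nat) (K : CpType R p).
Local Notation abs := (@padic_abs R p K).
Implicit Types (a b z : K) (u v : nat -> K) (B e : R).

Lemma padic_abs0 : abs 0 = 0.
Proof. exact/padic_abs_eq0. Qed.

Lemma padic_abs_gt0 z : z != 0 -> 0 < abs z.
Proof.
move=> z0; rewrite lt_neqAle padic_abs_ge0 andbT eq_sym.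
by apply/eqP => /padic_abs_eq0/eqP; apply/negP.
Qed.

Lemma padic_abs1 : abs 1 = 1.
Proof.
have n0 : abs 1 != 0 by rewrite gt_eqF // padic_abs_gt0 // oner_neq0.
by apply: (mulfI n0); rewrite mulr1 -padic_absM mulr1.
Qed.

Lemma padic_absX z n : abs (z ^+ n) = abs z ^+ n.
Proof.
by elim: n => [|n IHn]; rewrite ?expr0 ?padic_abs1 // !exprS padic_absM IHn.
Qed.

Lemma padic_absN1 : abs (-1) = 1.
Proof.
apply/eqP; rewrite -(@eqrXn2 _ 2) ?padic_abs_ge0 ?ler01 //.
by rewrite -padic_absX sqrrN !expr1n padic_abs1.
Qed.

Lemma padic_absN z : abs (- z) = abs z.
Proof. by rewrite -mulN1r padic_absM padic_absN1 mul1r. Qed.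

Lemma padic_absV z : abs z^-1 = (abs z)^-1.
Proof.
have [->|z0] := eqVneq z 0; first by rewrite invr0 padic_abs0 invr0.
have n0 : abs z != 0 by rewrite gt_eqF // padic_abs_gt0.
by apply: (mulfI n0); rewrite -padic_absM !divff // padic_abs1.
Qed.

Lemma padic_absD_le a b B : abs a <= B -> abs b <= B -> abs (a + b) <= B.
Proof.
by move=> aB bB; apply: le_trans (padic_absD a b) _; rewrite ge_max aB.
Qed.

Lemma padic_absD_lt a b B : abs a < B -> abs b < B -> abs (a + b) < B.
Proof.
by move=> aB bB; apply: le_lt_trans (padic_absD a b) _; rewrite gt_max aB.
Qed.

Lemma padic_absB_le a b B : abs a <= B -> abs b <= B -> abs (a - b) <= B.
Proof. by move=> aB bB; apply: padic_absD_le; rewrite ?padic_absN. Qed.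

Lemma padic_absB_lt a b B : abs a < B -> abs b < B -> abs (a - b) < B.
Proof. by move=> aB bB; apply: padic_absD_lt; rewrite ?padic_absN. Qed.

Lemma padic_distC a b : abs (a - b) = abs (b - a).
Proof. by rewrite -padic_absN opprB. Qed.

Lemma padic_abs_sum_le (I : Type) (r : seq I) (P : pred I) (F : I -> K) B :
  0 <= B -> (forall i, P i -> abs (F i) <= B) ->
  abs (\sum_(i <- r | P i) F i) <= B.
Proof.
move=> B0 FB; elim/big_ind : _ => //; first by rewrite padic_abs0.
by move=> a b; apply: padic_absD_le.
Qed.

Lemma padic_abs_nat_le1 n : abs n%:R <= 1.
Proof.
elim: n => [|n IHn]; first by rewrite padic_abs0 ler01.
by rewrite -natr1 padic_absD_le // padic_abs1.
Qed.

Lemma padic_abs_int_le1 (m : int) : abs m%:~R <= 1.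
Proof.
by case: m => n; rewrite ?NegzE ?mulrNz ?padic_absN padic_abs_nat_le1.
Qed.

Lemma abs_cvgP u a : abs_cvg abs u a <->
  forall e, 0 < e -> exists N, forall n, (N <= n)%N -> abs (u n - a) < e.
Proof.
split=> [/cvgr0_norm_lt cu e /cu [N _ uN]|cu].
  by exists N => n /uN/=; rewrite ger0_norm // padic_abs_ge0.
apply/cvgr0Pnorm_lt => e /cu[N uN]; exists N => // n /uN /=.
by rewrite ger0_norm // padic_abs_ge0.
Qed.

Lemma eq_abs_cvg u v a : u =1 v -> abs_cvg abs u a -> abs_cvg abs v a.
Proof. by move/funext ->. Qed.

Lemma abs_cvg_unique u a b : abs_cvg abs u a -> abs_cvg abs u b -> a = b.
Proof.
move=> /abs_cvgP ua /abs_cvgP ub; apply/eqP; rewrite -subr_eq0.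
apply/negPn/negP => /padic_abs_gt0 ab0.
(* The tolerance |a - b| itself works without halving: the ultrametric inequality yields |a - b| <
   |a - b|. *)
have [M uM] := ua _ ab0; have [N uN] := ub _ ab0.
have := padic_absB_lt (uN _ (leq_maxr M N)) (uM _ (leq_maxl M N)).
by rewrite (_ : _ - _ - _ = a - b) ?ltxx //; ring.
Qed.

Lemma padic_limE u a : abs_cvg abs u a -> padic_lim u = a.
Proof.
by move=> ua; apply: xget_unique => // b ub; apply: abs_cvg_unique ub ua.
Qed.

Lemma abs_cvg_cst a : abs_cvg abs (fun=> a) a.
Proof. by apply/abs_cvgP => e e0; exists 0 => n _;
  rewrite subrr padic_abs0. Qed.

Lemma abs_cvgD u v a b : abs_cvg abs u a -> abs_cvg abs v b ->
  abs_cvg abs (fun n => u n + v n) (a + b).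
Proof.
move=> /abs_cvgP ua /abs_cvgP vb; apply/abs_cvgP => e e0.
have [M uM] := ua _ e0; have [N vN] := vb _ e0.
exists (maxn M N) => n; rewrite geq_max => /andP[Mn Nn].
by rewrite opprD addrACA padic_absD_lt ?uM ?vN.
Qed.

Lemma abs_cvgZ c u a : abs_cvg abs u a -> abs_cvg abs (fun n => c * u n) (c *
  a).
Proof.
move=> /abs_cvgP ua; apply/abs_cvgP => e e0.
have c1 : 0 < abs c + 1 by rewrite ltr_wpDl // padic_abs_ge0.
have [N uN] := ua _ (divr_gt0 e0 c1); exists N => n /uN.
rewrite ltr_pdivlMr // -mulrBr padic_absM mulrDr mulr1 => h.
by rewrite mulrC; have := padic_abs_ge0 (u n - a); lra.
Qed.

Lemma abs_cvg_sum (I : Type) (r : seq I) (F : I -> nat -> K) (L : I -> K) :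
  (forall i, abs_cvg abs (F i) (L i)) ->
  abs_cvg abs (fun n => \sum_(i <- r) F i n) (\sum_(i <- r) L i).
Proof.
move=> FL; elim: r => [|i r IHr].
  by rewrite big_nil; apply: eq_abs_cvg (abs_cvg_cst _) => n; rewrite big_nil.
rewrite big_cons; apply: eq_abs_cvg (abs_cvgD (FL i) IHr) => n.
by rewrite big_cons.
Qed.

Lemma abs_cvg_le u a b B : (exists N, forall n, (N <= n)%N -> abs (u n - b) <=
  B) ->
  abs_cvg abs u a -> abs (a - b) <= B.
Proof.
move=> [N uB] /abs_cvgP ua; apply/ler_addgt0Pr => e e0; have [M uM] := ua _ e0.
have B0 : 0 <= B by apply: le_trans (padic_abs_ge0 _) (uB _ (leqnn N)).
rewrite (_ : a - b = (u (maxn M N) - b) - (u (maxn M N) - a)); last by ring.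
apply: padic_absB_le.
  by rewrite (le_trans (uB _ (leq_maxr _ _))) // lerDl ltW.
by rewrite (le_trans (ltW (uM _ (leq_maxl _ _)))) // lerDr.
Qed.

Definition has_sum u a := abs_cvg abs (series u) a.

Lemma eq_has_sum u v a : u =1 v -> has_sum u a -> has_sum v a.
Proof. by move/funext ->. Qed.

Lemma has_sum_unique u a b : has_sum u a -> has_sum u b -> a = b.
Proof. exact: abs_cvg_unique. Qed.

Lemma has_sumD u v a b : has_sum u a -> has_sum v b ->
  has_sum (fun n => u n + v n) (a + b).
Proof.
move=> ua vb; apply: eq_abs_cvg (abs_cvgD ua vb) => n.
by rewrite /series /= big_split.
Qed.

Lemma has_sumZ c u a : has_sum u a -> has_sum (fun n => c * u n) (c * a).
Proof.
move=> ua; apply: eq_abs_cvg (abs_cvgZ c ua) => n.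
by rewrite /series /= mulr_sumr.
Qed.

Lemma has_sum_sum (I : Type) (r : seq I) (F : I -> nat -> K) (L : I -> K) :
  (forall i, has_sum (F i) (L i)) ->
  has_sum (fun n => \sum_(i <- r) F i n) (\sum_(i <- r) L i).
Proof.
move=> FL; apply: eq_abs_cvg (abs_cvg_sum r FL) => n.
by rewrite /series /= exchange_big.
Qed.

Lemma has_sum_fin u N : (forall n, (N <= n)%N -> u n = 0) ->
  has_sum u (\sum_(n < N) u n).
Proof.
move=> uN; apply/abs_cvgP => e e0; exists N => n Nn.
rewrite /series /= -(big_mkord xpredT u) (big_cat_nat (n := N)) //=.
rewrite addrAC subrr add0r big_nat big1 ?padic_abs0 // => i /andP[Ni _].
exact: uN.
Qed.

Lemma has_sumS u a : has_sum (fun n => u n.+1) a -> has_sum u (u 0%N + a).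
Proof.
move=> /abs_cvgP ua; apply/abs_cvgP => e e0; have [N uN] := ua _ e0.
exists N.+1 => -[//|n] Nn; rewrite /series /= big_nat_recl // opprD.
by rewrite addrACA subrr add0r; apply: uN.
Qed.

Lemma series_tail_le u M n B : 0 <= B ->
  (forall i, (M <= i)%N -> abs (u i) <= B) -> (M <= n)%N ->
  abs (series u n - series u M) <= B.
Proof.
move=> B0 uB Mn; rewrite sub_series_geq // big_nat.
by apply: padic_abs_sum_le => // i /andP[Mi _]; apply: uB.
Qed.

Lemma has_sum_tail_le u a M B : 0 <= B ->
  (forall i, (M <= i)%N -> abs (u i) <= B) -> has_sum u a ->
  abs (a - series u M) <= B.
Proof.
by move=> B0 uB; apply: abs_cvg_le; exists M => n; apply: series_tail_le.
Qed.

(** A block of terms is no larger than its largest term, so terms tending to 0 already make the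
    partial sums Cauchy; completeness gives the sum. *)
Lemma has_sum_ex u : abs_cvg abs u 0 -> exists a, has_sum u a.
Proof.
move=> /abs_cvgP u0; apply: padic_complete => e e0.
have [N uN] := u0 _ (divr_gt0 e0 (ltr0Sn R 1)); exists N => // M NM m n Mm Mn.
have tail k : (M <= k)%N -> abs (series u k - series u M) <= e / 2.
  apply: series_tail_le; first by rewrite ltW // divr_gt0.
  by move=> i Mi; rewrite -[u i]subr0 ltW // uN // (leq_trans NM).
rewrite (_ : _ - _ = (series u m - series u M) - (series u n - series u M)).
  by apply: le_lt_trans (padic_absB_le (tail _ Mm) (tail _ Mn)) _; lra.
by ring.
Qed.

Lemma has_sum_cvg0 u a : has_sum u a -> abs_cvg abs u 0.
Proof.
move=> /abs_cvgP ua; apply/abs_cvgP => e e0; have [N uN] := ua _ e0.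
exists N => n Nn; rewrite subr0.
rewrite (_ : u n = (series u n.+1 - a) - (series u n - a)).
  by rewrite padic_absB_lt ?uN // (leq_trans Nn).
by rewrite seriesSr; ring.
Qed.

Lemma abs_cvg0_bounded u : abs_cvg abs u 0 ->
  exists2 B, 0 < B & forall n, abs (u n) <= B.
Proof.
move=> /abs_cvgP /(_ 1 ltr01)[N uN].
have s0 : 0 <= \sum_(i < N) abs (u i) by apply: sumr_ge0 => i _;
  apply: padic_abs_ge0.
exists (1 + \sum_(i < N) abs (u i)); first by rewrite ltr_pwDl.
move=> n; have [nN|/uN] := ltnP n N; last first.
  by rewrite subr0 => /ltW un1; rewrite (le_trans un1) // lerDl.
rewrite (bigD1 (Ordinal nN)) //= addrCA lerDl addr_ge0 ?sumr_ge0 //.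
by move=> i _; apply: padic_abs_ge0.
Qed.

Lemma abs_cvg0_le u (B : nat -> R) : (forall n, abs (u n) <= B n) ->
  B @ \oo --> (0 : R) -> abs_cvg abs u 0.
Proof.
move=> uB /cvgr0_norm_lt B0; apply/abs_cvgP => e /B0[N _ BN]; exists N => n Nn.
by rewrite subr0; apply: le_lt_trans (uB n) (le_lt_trans (ler_norm _) (BN _
  Nn)).
Qed.

(** Dominated convergence. A dominating sequence that tends to 0 takes the place of a summable one:
    past some [M] all tails are at most e / 2 uniformly in [N], and the finitely many columns before
    [M] converge. *)
Lemma tannery (f : nat -> nat -> K) (s : nat -> K) (g : nat -> K) (a : K)
    (B : nat -> R) :
  (forall N m, abs (f N m) <= B m) -> B @ \oo --> (0 : R) ->
  (forall m, abs_cvg abs (f^~ m) (g m)) ->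
  (forall N, has_sum (f N) (s N)) -> has_sum g a -> abs_cvg abs s a.
Proof.
move=> fB B0 fg fs ga; apply/abs_cvgP => e e0.
have e20 : 0 < e / 2 by rewrite divr_gt0.
have [M _ BM] := @cvgr0_norm_lt _ _ _ _ _ _ B0 _ e20.
have fM N m : (M <= m)%N -> abs (f N m) <= e / 2.
  by move=> Mm; rewrite (le_trans (fB _ _)) // (le_trans (ler_norm _)) // ltW
    // BM.
have gM m : (M <= m)%N -> abs (g m) <= e / 2.
  move=> Mm; rewrite -[g m]subr0; apply: abs_cvg_le (fg m).
  by exists 0%N => N _; rewrite subr0 fM.
have := @abs_cvg_sum _ (index_iota 0 M) (fun m N => f N m) g fg.
move=> /abs_cvgP /(_ _ e20)[N0 fN0]; exists N0 => N NN0.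
rewrite (_ : s N - a = (s N - series (f N) M) + (series (f N) M - series g M)
  - (a - series g M)); last by ring.
apply: (@le_lt_trans _ _ (e / 2)); last by lra.
apply: padic_absB_le; last by apply: has_sum_tail_le ga => //; apply: ltW.
apply: padic_absD_le; last by apply: ltW; apply: fN0.
by apply: has_sum_tail_le (fM N) (fs N); apply: ltW.
Qed.

(** This is [tannery] for the sums of the first [N] rows: by the ultrametric inequality, adding rows
    keeps the bound [B m] on column [m]. *)
Lemma has_sum_exchange (f : nat -> nat -> K) (r c : nat -> K) (a : K)
    (B : nat -> R) :
  (forall n m, abs (f n m) <= B m) -> B @ \oo --> (0 : R) ->
  (forall n, has_sum (f n) (r n)) -> (forall m, has_sum (f^~ m) (c m)) ->
  has_sum c a -> has_sum r a.
Proof.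
move=> fB B0 fr fc ca.
apply: (tannery (f := fun N m => series (f^~ m) N) _ B0 fc _ ca) => [N m|N].
  by apply: padic_abs_sum_le => //; apply: le_trans (padic_abs_ge0 _) (fB 0 m).
exact: has_sum_sum.
Qed.

Lemma has_sum_cauchy u v a b : has_sum u a -> has_sum v b ->
  has_sum (fun n => \sum_(i < n.+1) u i * v (n - i)%N) (a * b).
Proof.
move=> ua vb; have [B B0 vB] := abs_cvg0_bounded (has_sum_cvg0 vb).
(* Row [n] of this triangular array sums to the Cauchy coefficient of index [n]; column [i] is the
   series of [v] delayed by [i] and scaled by [u i]. *)
pose f n i := if (i <= n)%N then u i * v (n - i)%N else 0.
apply: (has_sum_exchange (f := f) (B := fun i => abs (u i) * B) _ _ _
  (c := fun i => u i * b)).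
- move=> n i; rewrite /f; case: ifP => _.
    by rewrite padic_absM ler_wpM2l // padic_abs_ge0.
  by rewrite padic_abs0 mulr_ge0 ?padic_abs_ge0 // ltW.
- rewrite -(mul0r B); apply: cvgMl; have := has_sum_cvg0 ua; rewrite /abs_cvg.
  by under eq_fun do rewrite subr0.
- move=> n; rewrite [X in has_sum _ X](_ : _ = \sum_(i < n.+1) f n i).
    by apply: has_sum_fin => i ni; rewrite /f leqNgt ni.
  by apply: eq_bigr => i _; rewrite /f -ltnS ltn_ord.
- move=> i; have /abs_cvgP ub := has_sumZ (u i) vb.
  apply/abs_cvgP => e /ub[N uN]; exists (i + N)%N => n iNn.
  have iN : (i <= n)%N by apply: leq_trans iNn; apply: leq_addr.
  rewrite /series /= (big_cat_nat (n := i)) //= big_nat big1 ?add0r; last first.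
    by move=> j /andP[_ ji]; rewrite /f leqNgt ji.
  rewrite -{1}[i]add0n big_addn (_ : \sum_(_ <= _ < _) _ =
    series (fun n => u i * v n) (n - i)%N).
    by apply: uN; rewrite leq_subRL.
  by apply: eq_bigr => j _; rewrite /f leq_addl addnK.
- under [X in has_sum X]eq_fun do rewrite mulrC.
  by rewrite mulrC; apply: has_sumZ.
Qed.

End Valuation.

(** * Legendre's estimate for the valuation of factorials *)

Section FactorialValuation.
Variables (p : nat) (p_prime : prime p).

(** Since p floor(n / p^(k+1)) <= floor(n / p^k), the sum telescopes to at most n minus its last
    quotient. *)
Lemma sum_divn_lt n m : (0 < n)%N ->
  (p.-1 * \sum_(1 <= k < m.+1) n %/ p ^ k < n)%N.
Proof.
have p_gt0 := prime_gt0 p_prime; move=> n_gt0.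
have le k : (p.-1 * \sum_(1 <= k < k.+1) n %/ p ^ k + n %/ p ^ k <= n)%N.
  elim: k => [|k IHk]; first by rewrite big_geq // muln0 expn0 divn1.
  rewrite big_nat_recr //= mulnDr -addnA -mulSnr prednK //.
  by apply: leq_trans IHk; rewrite leq_add2l expnSr divnMA mulnC leq_trunc_div.
elim: m => [|m IHm]; first by rewrite big_geq // muln0.
(* A zero quotient adds nothing to the sum; a positive one makes the telescoped bound strict. *)
have [d0|d_gt0] := posnP (n %/ p ^ m.+1).
  by rewrite big_nat_recr //= d0 addn0.
by apply: leq_trans (le m.+1); rewrite -addn1 leq_add2l.
Qed.

Lemma logn_fact_le n : (p.-1 * logn p n.+1`! <= n)%N.
Proof. by rewrite logn_fact // -ltnS sum_divn_lt. Qed.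

End FactorialValuation.

(** * Exponential, logarithm, powers q^x and q-numbers on their discs *)

Section ExpLog.
Variables (R : realType) (p : nat) (p_prime : prime p) (K : CpType R p).
Local Notation abs := (@padic_abs R p K).
Local Notation r := (exp_radius R p).
Implicit Types (a b t x y z q : K).

(** By Bezout, 1 = d p - k m for some natural numbers d and k; if |m| < 1, the right side would have
    absolute value below 1. *)
Lemma padic_abs_coprime m : coprime p m -> abs m%:R = 1.
Proof.
move=> cpm; apply/le_anti; rewrite padic_abs_nat_le1 leNgt; apply/negP => m1.
have [k _] := Bezoutl m (prime_gt0 p_prime).
rewrite (eqP cpm) => /dvdnP[d] /(congr1 (fun n : nat => n%:R : K)).
rewrite natrD !natrM => /(canRL (addrK _)) E.
suff : abs 1%:R < 1 by rewrite padic_abs1 ltxx.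
rewrite E; apply: padic_absB_lt; rewrite padic_absM.
  rewrite padic_abs_p ltr_pdivrMr ?ltr0n ?prime_gt0 // mul1r.
  by apply: le_lt_trans (padic_abs_nat_le1 K d) _; rewrite ltr1n prime_gt1.
by apply: le_lt_trans m1; rewrite ler_piMl ?padic_abs_ge0 ?padic_abs_nat_le1.
Qed.

Lemma padic_abs_nat n : (0 < n)%N -> abs n%:R = p%:R^-1 ^+ logn p n.
Proof.
move=> n0; have [m cpm ->] := pfactor_coprime p_prime n0.
rewrite natrM natrX padic_absM padic_absX padic_abs_p padic_abs_coprime //
  mul1r.
congr (_ ^+ _); have m0 : (0 < m)%N.
  by case: m cpm => //; rewrite /coprime gcdn0 => /eqP p1; move: p_prime;
    rewrite p1.
by rewrite lognM // ?expn_gt0 ?prime_gt0 // (logn_coprime cpm) pfactorK.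
Qed.

Lemma padic_natr_neq0 n : (0 < n)%N -> n%:R != 0 :> K.
Proof.
move=> n0; apply/eqP => /padic_abs_eq0/eqP; rewrite padic_abs_nat //.
by apply/negP; rewrite expf_neq0 // invr_neq0 // pnatr_eq0 -lt0n prime_gt0.
Qed.

Lemma padic_fact_neq0 n : n`!%:R != 0 :> K.
Proof. by rewrite padic_natr_neq0 ?fact_gt0. Qed.

Lemma exp_radius_gt0 : 0 < r.
Proof. by rewrite powR_gt0 // ltr0n prime_gt0. Qed.

Lemma exp_radiusX : r ^+ p.-1 = p%:R^-1.
Proof.
have p1 : (0 < p.-1)%N by rewrite -ltnS prednK ?prime_gt1 ?prime_gt0.
rewrite -powR_mulrn ?powR_ge0 // -powRrM mulNr mulVf ?powR_inv1 ?ler0n //.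
by rewrite pnatr_eq0 -lt0n.
Qed.

Lemma exp_radius_lt1 : r < 1.
Proof.
rewrite -(@expr_lt1 _ p.-1) ?ltW ?exp_radius_gt0 //; last first.
  by rewrite -ltnS prednK ?prime_gt1 ?prime_gt0.
by rewrite exp_radiusX invf_lt1 ?ltr0n ?ltr1n ?prime_gt0 ?prime_gt1.
Qed.

(** Here r^(p-1) < r because p - 1 > 1; at p = 2 both sides would be 1/2. The inequality places p
    inside the open disc of radius r. *)
Lemma inv_p_lt_exp_radius : odd p -> p%:R^-1 < r.
Proof.
move=> p_odd; rewrite -exp_radiusX -{2}[r]expr1.
rewrite ltr_iXn2l ?exp_radius_gt0 ?exp_radius_lt1 //.
by case: p p_odd (prime_gt1 p_prime) => [//|[//|[//|n]]].
Qed.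

(** With v the valuation of (n+1)!, its absolute value is p^(-v) = r^((p-1)v), and (p-1)v <= n by
    Legendre's estimate. *)
Lemma padic_abs_fact_ge n : r ^+ n <= abs n.+1`!%:R.
Proof.
rewrite padic_abs_nat ?fact_gt0 // -exp_radiusX -exprM.
apply: ler_wiXn2l; rewrite ?ltW ?exp_radius_gt0 ?exp_radius_lt1 //.
exact: logn_fact_le.
Qed.

Lemma ratio_ge0 z : 0 <= abs z / r.
Proof. by rewrite divr_ge0 ?padic_abs_ge0 // ltW // exp_radius_gt0. Qed.

Lemma ratio_cvg0 z : abs z < r -> (fun n => (abs z / r) ^+ n) @ \oo --> (0 : R).
Proof.
move=> zr; apply: cvg_expr; rewrite ger0_norm ?ratio_ge0 //.
by rewrite ltr_pdivrMr ?exp_radius_gt0 // mul1r.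
Qed.

Lemma ratioX_le1 z n : abs z < r -> (abs z / r) ^+ n <= 1.
Proof.
move=> zr; rewrite exprn_ile1 ?ratio_ge0 //.
by rewrite ler_pdivrMr ?exp_radius_gt0 // mul1r ltW.
Qed.

(** The factorial bound costs only n powers of r against n + 1 powers of z. The factor |z| saved
    here is what later gives |exp z - 1| <= |z|. *)
Lemma exp_term_le z n :
  abs (z ^+ n.+1 / n.+1`!%:R) <= abs z * (abs z / r) ^+ n.
Proof.
rewrite padic_absM padic_absV padic_absX exprS -mulrA ler_wpM2l ?padic_abs_ge0
  //.
rewrite expr_div_n ler_wpM2l ?exprn_ge0 ?padic_abs_ge0 // lef_pV2 ?posrE.
- exact: padic_abs_fact_ge.
- by rewrite padic_abs_gt0 // padic_fact_neq0.
- by rewrite exprn_gt0 // exp_radius_gt0.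
Qed.

Lemma exp_term_le_ratio z n : abs (z ^+ n / n`!%:R) <= (abs z / r) ^+ n.
Proof.
case: n => [|n]; first by rewrite !expr0 fact0 divr1 padic_abs1.
apply: le_trans (exp_term_le z n) _; rewrite exprS ler_wpM2r ?exprn_ge0
  ?ratio_ge0 //.
rewrite ler_pdivlMr ?exp_radius_gt0 // ler_piMr ?padic_abs_ge0 // ltW //.
exact: exp_radius_lt1.
Qed.

Lemma has_sum_exp z : abs z < r ->
  has_sum (fun n => z ^+ n / n`!%:R) (padic_exp z).
Proof.
move=> zr; have [s zs] := has_sum_ex (abs_cvg0_le (exp_term_le_ratio z)
  (ratio_cvg0 zr)).
by rewrite /padic_exp (padic_limE zs).
Qed.

Lemma padic_exp_sub1_le z : abs z < r -> abs (padic_exp z - 1) <= abs z.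
Proof.
move=> zr; have : series (fun n => z ^+ n / n`!%:R) 1 = 1.
  by rewrite /series /= big_nat1 expr0 fact0 divr1.
move=> {1}<-; apply: has_sum_tail_le (has_sum_exp zr).
  exact: padic_abs_ge0.
case=> // n _; apply: le_trans (exp_term_le z n) _.
by rewrite ler_piMr ?padic_abs_ge0 ?ratioX_le1.
Qed.

(** The Cauchy product of the two series is the series at a + b, by the binomial theorem. *)
Lemma padic_expD a b : abs a < r -> abs b < r ->
  padic_exp (a + b) = padic_exp a * padic_exp b.
Proof.
move=> ar br; have abr : abs (a + b) < r by apply: padic_absD_lt.
apply: has_sum_unique (has_sum_exp abr) _.
apply: eq_has_sum (has_sum_cauchy (has_sum_exp ar) (has_sum_exp br)) => n.
rewrite addrC exprDn mulr_suml; apply: eq_bigr => i _.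
have ik : (i <= n)%N by rewrite -ltnS.
rewrite -mulr_natr.
have <- : ('C(n, i)%:R * (i`!%:R * (n - i)`!%:R)) = n`!%:R :> K.
  by rewrite -!natrM bin_fact.
field; rewrite !padic_fact_neq0 /= padic_natr_neq0 // bin_gt0 //.
Qed.

Lemma has_sum_log a : abs (a - 1) < r ->
  has_sum (fun n => (-1) ^+ n * (a - 1) ^+ n.+1 / n.+1%:R) (padic_log a) /\
  abs (padic_log a) <= abs (a - 1).
Proof.
move=> ar; set u := fun n : nat => _.
(* Since |(n+1)!| <= |n+1|, each logarithm term is dominated by the exponential term of the same
   degree. *)
have uB n : abs (u n) <= abs (a - 1) * (abs (a - 1) / r) ^+ n.
  apply: le_trans (exp_term_le _ n).
  rewrite /u -mulrA [leLHS]padic_absM padic_absX padic_absN1 expr1n mul1r.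
  rewrite !padic_absM ler_wpM2l ?padic_abs_ge0 // !padic_absV lef_pV2 ?posrE.
  - by rewrite factS natrM padic_absM ler_piMr ?padic_abs_ge0
    ?padic_abs_nat_le1.
  - by rewrite padic_abs_gt0 // padic_natr_neq0.
  - by rewrite padic_abs_gt0 // padic_fact_neq0.
have B0 : (fun n => abs (a - 1) * (abs (a - 1) / r) ^+ n) @ \oo --> (0 : R).
  by rewrite -(mulr0 (abs (a - 1))); apply: cvgMr; apply: ratio_cvg0.
have [s us] := has_sum_ex (abs_cvg0_le uB B0).
rewrite /padic_log (padic_limE us); split=> //.
(* The whole sum is its own tail from index 0, so the tail estimate bounds |log a|. *)
have -> : s = s - series u 0 by rewrite /series /= big_geq // subr0.
apply: has_sum_tail_le us => [|n _]; first exact: padic_abs_ge0.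
by apply: le_trans (uB n) _; rewrite ler_piMr ?padic_abs_ge0 ?ratioX_le1.
Qed.

Lemma mul_log_lt q z : abs (1 - q) < r -> abs z <= 1 ->
  abs (z * padic_log q) < r.
Proof.
rewrite padic_distC => qr z1; apply: (le_lt_trans _ qr); rewrite padic_absM.
have [_ lq] := has_sum_log qr; apply: le_trans lq.
by rewrite ler_piMl ?padic_abs_ge0.
Qed.

Lemma padic_powD q x y : abs (1 - q) < r -> abs x <= 1 -> abs y <= 1 ->
  padic_pow q (x + y) = padic_pow q x * padic_pow q y.
Proof.
by move=> qr x1 y1; rewrite /padic_pow mulrDl padic_expD ?mul_log_lt.
Qed.

Lemma padic_pow_sub1_le q x : abs (1 - q) < r -> abs x <= 1 ->
  abs (padic_pow q x - 1) <= abs x * abs (1 - q).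
Proof.
move=> qr x1; apply: le_trans (padic_exp_sub1_le (mul_log_lt qr x1)) _.
rewrite padic_absM ler_wpM2l ?padic_abs_ge0 // (padic_distC 1).
by apply: (has_sum_log _).2; rewrite padic_distC.
Qed.

Lemma padic_pow_le1 q x : abs (1 - q) < r -> abs x <= 1 ->
  abs (padic_pow q x) <= 1.
Proof.
move=> qr x1; rewrite -(subrK 1 (padic_pow q x)) padic_absD_le ?padic_abs1 //.
apply: le_trans (padic_pow_sub1_le qr x1) _.
rewrite mulr_ile1 ?padic_abs_ge0 // ltW // (lt_trans qr) //.
exact: exp_radius_lt1.
Qed.

Lemma padic_pow0 q : abs (1 - q) < r -> padic_pow q 0 = 1.
Proof.
move=> qr; apply/eqP; rewrite -subr_eq0; apply/eqP/padic_abs_eq0/le_anti.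
have := padic_pow_sub1_le (x := 0) qr.
by rewrite padic_abs0 mul0r padic_abs_ge0 => -> //; apply: ler01.
Qed.

Lemma padic_pow_natM q x n : abs (1 - q) < r -> abs x <= 1 ->
  padic_pow q (n%:R * x) = padic_pow q x ^+ n.
Proof.
move=> qr x1; elim: n => [|n IHn]; first by rewrite mul0r padic_pow0.
rewrite mulrS mulrDl mul1r padic_powD // ?IHn ?exprS //.
by rewrite padic_absM mulr_ile1 ?padic_abs_ge0 ?padic_abs_nat_le1.
Qed.

Lemma qnum_le q x : abs (1 - q) < r -> abs x <= 1 -> abs (qnum q x) <= abs x.
Proof.
move=> qr x1; rewrite /qnum; case: eqP => // /eqP q1.
rewrite padic_absM padic_absV ler_pdivrMr ?padic_abs_gt0 ?subr_eq0 //.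
by rewrite (padic_distC q); apply: padic_pow_sub1_le.
Qed.

Lemma qnumD q x y : abs (1 - q) < r -> abs x <= 1 -> abs y <= 1 ->
  qnum q (x + y) = qnum q x + padic_pow q x * qnum q y.
Proof.
move=> qr x1 y1; rewrite /qnum; case: eqP => [q1|/eqP q1].
  (* At q = 1 the bound |q^x - 1| <= |x| |1 - q| forces q^x = 1, and the rule becomes ordinary
     addition. *)
  have := padic_pow_sub1_le qr x1; rewrite {2}q1 subrr padic_abs0 mulr0.
  move=> h; have /padic_abs_eq0/eqP : abs (padic_pow q x - 1) = 0.
    by apply/le_anti; rewrite h padic_abs_ge0.
  by rewrite subr_eq0 => /eqP ->; rewrite mul1r.
by rewrite padic_powD // mulrA -mulrDl; congr (_ / _); ring.
Qed.

End ExpLog.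

(** * Binomial polynomials and Stirling numbers of the first kind *)

Section Stirling.
Variable F : fieldType.
Hypothesis natF_neq0 : forall n, n.+1%:R != 0 :> F.

(** The binomial coefficient binom(X, n) as a polynomial in X. *)
Definition binom_poly n : {poly F} := n`!%:R^-1 *: \prod_(i < n) ('X - i%:R%:P).

Lemma coef_binom_poly n k : (binom_poly n)`_k = (stirling1 n k)%:~R / n`!%:R.
Proof.
rewrite coefZ mulrC /stirling1 -(coef_map (intr : int -> F)) rmorph_prod.
by under [in RHS]eq_bigr do rewrite rmorphB /= map_polyX map_polyC /= -pmulrn.
Qed.

Lemma binom_polyS n :
  n.+1%:R *: binom_poly n.+1 = ('X - n%:R%:P) * binom_poly n.
Proof.
rewrite /binom_poly big_ord_recr /= scalerA factS natrM invfM mulrA divff //.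
by rewrite mul1r -scalerAr mulrC.
Qed.

(* This is the coefficient of y in Vandermonde's identity
   binom(x + y, n + 1) = sum_i binom(x, i) binom(y, n + 1 - i). *)
Lemma deriv_binom_poly n : (binom_poly n.+1)^`() =
  \sum_(i < n.+1) ((-1) ^+ (n - i) / (n - i).+1%:R) *: binom_poly i.
Proof.
pose e m : F := (-1) ^+ m / m.+1%:R.
have mul_e m : m.+1%:R * e m = (-1) ^+ m by rewrite mulrC divfK.
transitivity (\sum_(i < n.+1) e (n - i)%N *: binom_poly i); last by [].
elim: n => [|n IHn].
  rewrite big_ord_recr big_ord0 /= add0r /binom_poly !big_ord_recr !big_ord0 /=.
  by rewrite /e expr0 !divr1 !invr1 !scale1r !mul1r !subr0 derivX.
apply: (scalerI (natF_neq0 n.+1)).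
rewrite -derivZ binom_polyS derivM derivXsubC mul1r IHn mulr_sumr.
(* Writing X - (n+1) = (X - i) - (n-i+1), the first part raises binom(X, i) to (i+1) binom(X, i+1),
   and the second cancels the denominator of [e (n - i)]. *)
transitivity (binom_poly n.+1 +
    \sum_(i < n.+1) ((i.+1%:R * e (n - i)%N) *: binom_poly i.+1
                     + (-1) ^+ (n.+1 - i) *: binom_poly i)).
  congr (_ + _); apply: eq_bigr => i _; have le_in : (i <= n)%N by rewrite
    -ltnS.
  rewrite [i.+1%:R * _]mulrC -[(_ * i.+1%:R) *: _]scalerA binom_polyS subSn //
    exprS mulN1r -mul_e.
  have -> : n.+1%:R = i%:R + (n - i).+1%:R :> F.
    by rewrite -natrD addnS subnKC.
  rewrite polyCD opprD addrA mulrDl -scalerAr; congr (_ + _).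
  by rewrite mulNr mul_polyC scalerA scaleNr.
rewrite scaler_sumr big_split /= addrCA.
(* The raised terms are reindexed, with a zero term added at i = 0; the isolated binom(X, n+1)
   becomes the term i = n+1 of the alternating sum. *)
transitivity (\sum_(i < n.+2) ((i%:R * e (n.+1 - i)%N) *: binom_poly i
                     + (-1) ^+ (n.+1 - i) *: binom_poly i)).
  rewrite big_split /= [X in _ = X + _]big_ord_recl /= mul0r scale0r add0r.
  congr (_ + _).
  by rewrite [RHS]big_ord_recr /= subnn expr0 scale1r addrC.
(* The sign equals (n+2-i) [e (n.+1 - i)], so the two coefficients add up to (n+2)
   [e (n.+1 - i)]. *)
apply: eq_bigr => i _; have le_in : (i <= n.+1)%N by rewrite -ltnS.
by rewrite -scalerDl [RHS]scalerA -mul_e -mulrDl -natrD addnS subnKC.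
Qed.

Lemma stirling10 n : stirling1 n 0 = (n == 0)%N.
Proof.
rewrite /stirling1 -horner_coef0; case: n => [|n].
  by rewrite big_ord0 hornerC.
by rewrite big_ord_recl hornerM hornerXsubC subrr mul0r.
Qed.

Lemma stirling1_small n k : (n < k)%N -> stirling1 n k = 0.
Proof.
move=> nk; rewrite /stirling1 nth_default // size_prod_XsubC.
by rewrite -[index_enum _]enumT size_enum_ord.
Qed.

End Stirling.

(** * Expansion of powers of log(1+t) in Stirling numbers *)

Section LogPowers.
Variables (R : realType) (p : nat) (p_prime : prime p) (K : CpType R p).
Local Notation abs := (@padic_abs R p K).
Local Notation r := (exp_radius R p).
Implicit Types (t : K).

(** Comparing coefficients of X^m in [deriv_binom_poly] gives the convolution that matches
    multiplication by the logarithm series. *)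
Lemma stirling1_fact_rec n m :
  m.+1%:R * ((stirling1 n.+1 m.+1)%:~R / n.+1`!%:R) =
  \sum_(i < n.+1) (stirling1 i m)%:~R / i`!%:R *
    ((-1) ^+ (n - i) / (n - i).+1%:R) :> K.
Proof.
have nat_neq0 k : k.+1%:R != 0 :> K by rewrite padic_natr_neq0.
have := congr1 (fun P : {poly K} => P`_m) (deriv_binom_poly nat_neq0 n).
rewrite coef_deriv coef_binom_poly mulr_natl => ->.
by rewrite coef_sum; apply: eq_bigr => i _; rewrite coefZ coef_binom_poly mulrC.
Qed.

(** Induction on [m]: the Cauchy product of the series of L^m/m! with that of L = log(1+t), divided
    by m+1, has the coefficients given by [stirling1_fact_rec]. *)
Lemma has_sum_log_pow t m : abs t < r ->
  has_sum (fun n => (stirling1 n m)%:~R * (t ^+ n / n`!%:R))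
          (padic_log (1 + t) ^+ m / m`!%:R).
Proof.
move=> tr; have t1 : abs (1 + t - 1) < r by rewrite addrC addKr.
have [log_sum _] := has_sum_log p_prime t1.
elim: m => [|m IHm].
  rewrite (_ : _ / _ = \sum_(n < 1) (stirling1 n 0)%:~R * (t ^+ n / n`!%:R)).
    by apply: has_sum_fin => -[//|n] _; rewrite stirling10 mul0r.
  by rewrite big_ord1 /= stirling10 !expr0 mulr1z mul1r.
have nz : m.+1%:R != 0 :> K by rewrite padic_natr_neq0.
have := has_sumZ m.+1%:R^-1 (has_sum_cauchy IHm log_sum).
rewrite (_ : _ * (_ * _) = padic_log (1 + t) ^+ m.+1 / m.+1`!%:R); last first.
  by rewrite exprSr factS natrM invfM; ring.
(* The logarithm series starts at t, so index n of the product carries t^(n+1); the missing constant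
   term is 0. *)
move=> S; have u0 : (stirling1 0 m.+1)%:~R * (t ^+ 0 / 0`!%:R) = 0 :> K.
  by rewrite stirling1_small // mul0r.
rewrite -[X in has_sum _ X]add0r -[X in X + _]u0.
apply: has_sumS; apply: eq_has_sum S => n.
apply: (mulfI nz); rewrite mulVKf // addrC addKr.
transitivity (m.+1%:R * ((stirling1 n.+1 m.+1)%:~R / n.+1`!%:R) * t ^+ n.+1);
  last by ring.
rewrite stirling1_fact_rec mulr_suml; apply: eq_bigr => i _.
have -> : t ^+ n.+1 = t ^+ i * t ^+ (n - i).+1 by rewrite -exprD addnS subnKC
  // -ltnS.
by ring.
Qed.

End LogPowers.

(** * Convergence of fermionic averages and moments of q-numbers *)

Section Integral.
Variables (R : realType) (p : nat) (p_prime : prime p) (p_odd : odd p).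
Variable K : CpType R p.
Local Notation abs := (@padic_abs R p K).
Local Notation r := (exp_radius R p).
Variables (q : K) (hq : abs (1 - q) < r).
Implicit Types (f : K -> K).

Definition fermionic_avg f N : K :=
  (qnumN q (p ^ N))^-1 * \sum_(y < p ^ N) f (y : nat)%:R * (- q) ^+ y.

Lemma abs_base_le1 : abs q <= 1.
Proof.
rewrite -(subKr 1 q) padic_absB_le ?padic_abs1 //.
by rewrite ltW // (lt_trans hq) // exp_radius_lt1.
Qed.

(** As |q^m - 1| < 1, the value |1 + q^m| < 1 would give |2| < 1, which is impossible for odd p. *)
Lemma abs_1DX m : abs (1 + q ^+ m) = 1.
Proof.
have qm : abs (q ^+ m - 1) < 1.
  rewrite subrX1 padic_absM; apply: le_lt_trans (lt_trans hq (exp_radius_lt1 R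
    p_prime)).
  rewrite padic_distC ler_piMr ?padic_abs_ge0 // padic_abs_sum_le // => i _.
  by rewrite padic_absX exprn_ile1 ?padic_abs_ge0 ?abs_base_le1.
have two : abs (2%:R : K) = 1.
  by rewrite padic_abs_coprime // coprime_sym coprime2n.
apply/le_anti/andP; split.
  by rewrite padic_absD_le ?padic_abs1 // padic_absX exprn_ile1 ?padic_abs_ge0
    ?abs_base_le1.
rewrite leNgt; apply/negP => h; have := padic_absB_lt h qm.
by rewrite (_ : _ - _ = 2%:R) ?two ?ltxx //; ring.
Qed.

Lemma oppX_pow N : (- q) ^+ (p ^ N) = - q ^+ (p ^ N).
Proof. by rewrite exprNn -signr_odd oddX p_odd orbT expr1 mulN1r. Qed.

Lemma abs_qnumN N : abs (qnumN q (p ^ N)) = 1.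
Proof.
rewrite /qnumN oppX_pow opprK padic_absM padic_absV abs_1DX.
by rewrite -[X in 1 + X]expr1 abs_1DX invr1 mul1r.
Qed.

Lemma abs_oppX_le1 m : abs ((- q) ^+ m) <= 1.
Proof. by rewrite padic_absX padic_absN exprn_ile1 ?padic_abs_ge0
  ?abs_base_le1. Qed.

Lemma fermionic_avg_le f N (B : R) : 0 <= B ->
  (forall y : nat, abs (f y%:R) <= B) -> abs (fermionic_avg f N) <= B.
Proof.
move=> B0 fB; rewrite padic_absM padic_absV abs_qnumN invr1 mul1r.
apply: padic_abs_sum_le => // y _; rewrite padic_absM.
by apply: le_trans (fB y); rewrite ler_piMr ?padic_abs_ge0 ?abs_oppX_le1.
Qed.

Lemma sum_ord_mul (V : nmodType) m n (F : nat -> V) :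
  \sum_(i < m * n) F i = \sum_(a < m) \sum_(y < n) F (a * n + y)%N.
Proof.
elim: m => [|m IHm]; first by rewrite !big_ord0.
by rewrite big_ord_recr /= -IHm mulSnr big_split_ord.
Qed.

(* The weights of a block a p^N + [0, p^N) are those of [0, p^N) multiplied by
   (-q)^(a p^N), and the sum of these factors is [p^(N+1)]_{-q} / [p^N]_{-q}. *)
Lemma fermionic_avg_step f N :
  (forall y h : nat, abs (f (y + h)%:R - f y%:R) <= abs h%:R) ->
  abs (fermionic_avg f N.+1 - fermionic_avg f N) <= p%:R^-1 ^+ N.
Proof.
move=> f_lip; pose M := (p ^ N)%N; pose G := \sum_(a < p) (- q) ^+ (a * M).
have D_neq0 k : qnumN q (p ^ k) != 0.
  by apply/eqP => /padic_abs_eq0/eqP; rewrite abs_qnumN oner_eq0.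
have GE : qnumN q (p ^ N.+1) = qnumN q M * G.
  rewrite /qnumN expnS mulnC exprM -(opprB _ 1) subrX1 -mulNr opprB mulrAC.
  by congr (_ * _); apply: eq_bigr => a _; rewrite mulnC exprM.
have G_neq0 : G != 0.
  by have := D_neq0 N.+1; rewrite GE mulf_eq0 negb_or => /andP[].
(* Over the common denominator only the increments f(y + aM) - f(y) remain, each at most |aM| <=
   p^(-N). *)
rewrite (_ : _ - _ = (qnumN q (p ^ N.+1))^-1 *
  \sum_(a < p) \sum_(y < M) (f (y + a * M)%:R - f y%:R) * (- q) ^+ (a * M + y)).
  rewrite padic_absM padic_absV abs_qnumN invr1 mul1r.
  have pN0 : 0 <= p%:R^-1 ^+ N :> R by rewrite exprn_ge0 // invr_ge0.
  apply: padic_abs_sum_le => // a _; apply: padic_abs_sum_le => // y _.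
  rewrite padic_absM; apply: le_trans (_ : abs (a * M)%:R <= _).
    by apply: le_trans (f_lip y (a * M)%N);
      rewrite ler_piMr ?padic_abs_ge0 ?abs_oppX_le1.
  rewrite natrM padic_absM natrX padic_absX padic_abs_p.
  by rewrite ler_piMl // padic_abs_nat_le1.
have sumE (F : nat -> K) :
    \sum_(y < p ^ N.+1) F y = \sum_(a < p) \sum_(y < M) F (a * M + y)%N.
  by rewrite expnS sum_ord_mul.
rewrite /fermionic_avg (sumE (fun y => f y%:R * (- q) ^+ y)) -/M.
have -> : (qnumN q M)^-1 = (qnumN q (p ^ N.+1))^-1 * G.
  by rewrite GE; field; rewrite (D_neq0 N) G_neq0.
rewrite -mulrA -mulrBr; congr (_ * _); rewrite mulr_suml -sumrB.
apply: eq_bigr => a _; rewrite mulr_sumr -sumrB; apply: eq_bigr => y _.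
by rewrite exprD addnC; ring.
Qed.

(** The averages are the partial sums of their increments, which tend to 0. *)
Lemma fermionic_avg_cvg f :
  (forall y h : nat, abs (f (y + h)%:R - f y%:R) <= abs h%:R) ->
  abs_cvg abs (fermionic_avg f) (fermionic_integral q f).
Proof.
move=> f_lip; suff [s fs] : exists s, abs_cvg abs (fermionic_avg f) s.
  by rewrite /fermionic_integral (padic_limE fs).
pose u N := fermionic_avg f N.+1 - fermionic_avg f N.
have [|s us] := @has_sum_ex _ _ _ u.
  apply: abs_cvg0_le (fun N => fermionic_avg_step N f_lip) _.
  apply: cvg_expr; rewrite ger0_norm ?invr_ge0 // invf_lt1 ?ltr0n ?ltr1n //.
    exact: prime_gt1.
  exact: prime_gt0.
exists (s + fermionic_avg f 0); apply: eq_abs_cvg (abs_cvgD us (abs_cvg_cst _))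
  => N.
by rewrite /series /= telescope_sumr // subrK.
Qed.

(** Factoring a difference of powers reduces to l = 1, where the increment is q^(x+y) [h]_q. *)
Lemma qnumX_lip x l (y h : nat) : abs x <= 1 ->
  abs (qnum q (x + (y + h)%:R) ^+ l - qnum q (x + y%:R) ^+ l) <= abs (h%:R : K).
Proof.
move=> x1; have nat1 := padic_abs_nat_le1 K.
have xy1 (k : nat) : abs (x + k%:R) <= 1 by apply: padic_absD_le.
have qn1 (k : nat) : abs (qnum q (x + k%:R)) <= 1.
  by apply: le_trans (qnum_le p_prime hq _) _.
rewrite subrXX padic_absM -[leRHS]mulr1; apply: ler_pM;
  rewrite ?padic_abs_ge0 //.
  rewrite natrD addrA (qnumD p_prime hq (xy1 y)) // addrAC subrr add0r
    padic_absM.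
  apply: le_trans (qnum_le p_prime hq (nat1 h)).
  by rewrite ler_piMl ?padic_abs_ge0 // padic_pow_le1.
apply: padic_abs_sum_le => // i _; rewrite padic_absM !padic_absX.
by rewrite mulr_ile1 ?exprn_ile1 ?exprn_ge0 ?padic_abs_ge0.
Qed.

(** Expanding ([x]_q + q^x [y]_q)^l inside each average leaves a finite combination of the averages
    defining the Carlitz numbers. *)
Lemma qnumX_avg_cvg x l : abs x <= 1 ->
  abs_cvg abs (fermionic_avg (fun y => qnum q (x + y) ^+ l))
    (\sum_(i < l.+1) 'C(l, i)%:R * qnum q x ^+ (l - i)
        * padic_pow q (i%:R * x) * carlitz_euler q i).
Proof.
move=> x1; have x01 : abs (0 : K) <= 1 by rewrite padic_abs0.
have euler i : abs_cvg abs (fermionic_avg (fun y => qnum q y ^+ i))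
  (carlitz_euler q i).
  apply: fermionic_avg_cvg => y h.
  by have := qnumX_lip i y h x01; rewrite !add0r.
have := abs_cvg_sum (index_enum 'I_l.+1) (fun i : 'I_l.+1 => abs_cvgZ
  ('C(l, i)%:R * qnum q x ^+ (l - i) * padic_pow q (i%:R * x)) (euler i)).
apply: eq_abs_cvg => N; rewrite /fermionic_avg.
under eq_bigr do rewrite mulrCA mulr_sumr.
rewrite -mulr_sumr exchange_big; congr (_ * _); apply: eq_bigr => y _ /=.
rewrite qnumD ?padic_abs_nat_le1 // exprDn mulr_suml; apply: eq_bigr => i _.
by rewrite padic_pow_natM // exprMn -mulr_natl; ring.
Qed.

End Integral.

(** * The generating function and uniqueness of its coefficients *)

Section GeneratingFunction.
Variables (R : realType) (p : nat) (p_prime : prime p) (p_odd : odd p).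
Variable K : CpType R p.
Local Notation abs := (@padic_abs R p K).
Local Notation r := (exp_radius R p).

(** Strong induction: at t = p^(j+1) the earlier coefficients vanish, so the term of index n is
    minus the later tail. This gives |d_n p^n| <= B p^(-j) for every j. *)
Lemma has_sum_powser_eq0 (d : nat -> K) :
  (forall t, abs t < r -> has_sum (fun n => d n * t ^+ n) 0) ->
  forall n, d n = 0.
Proof.
move=> dS n; have [m] := ubnP n; elim: m n => // m IHm n; rewrite ltnS => nm.
have rho_gt0 : 0 < p%:R^-1 :> R by rewrite invr_gt0 ltr0n prime_gt0.
have rho_lt1 : p%:R^-1 < 1 :> R by rewrite invf_lt1 ?ltr0n ?ltr1n ?prime_gt0
  ?prime_gt1.
have [rho_ge0 rho_le1] := (ltW rho_gt0, ltW rho_lt1).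
have pj_lt j : abs (p%:R ^+ j.+1) < r.
  apply: le_lt_trans (inv_p_lt_exp_radius R p_prime p_odd).
  by rewrite padic_absX padic_abs_p exprS ler_piMr // exprn_ile1.
(* Convergence at t = p bounds all |d_i p^i| by [B]. *)
have [B B_gt0 dB] := abs_cvg0_bounded (has_sum_cvg0 (dS _ (pj_lt 0%N))).
have bound j : abs (d n * p%:R ^+ n) <= B * p%:R^-1 ^+ j.
  have pnj i : p%:R ^+ j.+1 ^+ i = p%:R ^+ i * p%:R ^+ (j * i) :> K.
    by rewrite -exprM mulSn exprD.
  have := @has_sum_tail_le _ _ K (fun i => d i * p%:R ^+ j.+1 ^+ i) 0 n.+1
    (B * p%:R^-1 ^+ (j * n.+1)).
  rewrite sub0r padic_absN seriesSr [series _ n]big_nat big1 => [|i /andP[_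
    i_n]].
    rewrite add0r pnj mulrA padic_absM [X in _ * X <= _]padic_absX padic_abs_p
      => tail.
    have := tail _ _ (dS _ (pj_lt j)); rewrite mulnS exprD mulrA ler_pM2r
      ?exprn_gt0 //.
    apply=> [|i ni]; first by rewrite !mulr_ge0 ?exprn_ge0 // ltW.
    rewrite pnj mulrA padic_absM -mulrA -exprD -mulnS; apply: ler_pM;
      rewrite ?padic_abs_ge0 //.
    rewrite padic_absX padic_abs_p; apply: ler_wiXn2l => //.
    by rewrite leq_mul2l ni orbT.
  by rewrite IHm ?mul0r // (leq_trans i_n).
have cv : (fun j => B * p%:R^-1 ^+ j) @ \oo --> (0 : R).
  by rewrite -(mulr0 B); apply: cvgMr; apply: cvg_expr; rewrite ger0_norm.
have pn_neq0 : p%:R ^+ n != 0 :> K.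
  by rewrite expf_neq0 // padic_natr_neq0 // prime_gt0.
apply: (mulIf pn_neq0); rewrite mul0r; apply/eqP/negPn/negP => /padic_abs_gt0
  dn_gt0.
have [j _ /(_ j (leqnn j))] := @cvgr0_norm_lt _ _ _ _ _ _ cv _ dn_gt0.
by move=> /= /(le_lt_trans (ler_norm _)); rewrite ltNge bound.
Qed.

Variables (q x : K) (hq : abs (1 - q) < r) (x1 : abs x <= 1).

(** The moment E_m, in the expanded form that [qnumX_avg_cvg] yields as a limit. *)
Definition qnum_moment m : K :=
  \sum_(l < m.+1) 'C(m, l)%:R * qnum q x ^+ (m - l)
        * padic_pow q (l%:R * x) * carlitz_euler q l.

Lemma abs_qnum_nat_le1 (y : nat) : abs (qnum q (x + y%:R)) <= 1.
Proof.
have xy1 : abs (x + y%:R) <= 1 by rewrite padic_absD_le ?padic_abs_nat_le1.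
exact: le_trans (qnum_le p_prime hq xy1) xy1.
Qed.

Lemma qnumX_avg_le1 m N : abs (fermionic_avg q (fun y => qnum q (x + y) ^+ m)
  N) <= 1.
Proof.
apply: fermionic_avg_le => // y.
by rewrite padic_absX exprn_ile1 ?padic_abs_ge0 ?abs_qnum_nat_le1.
Qed.

Lemma qnum_moment_le1 m : abs (qnum_moment m) <= 1.
Proof.
rewrite -[qnum_moment m]subr0; apply: abs_cvg_le (qnumX_avg_cvg p_prime p_odd
  hq m x1).
by exists 0%N => N _; rewrite subr0 qnumX_avg_le1.
Qed.

Lemma has_sum_qnum_moment t : abs t < r ->
  has_sum (fun m => padic_log (1 + t) ^+ m / m`!%:R * qnum_moment m)
    (fermionic_integral q (fun y => padic_pow (1 + t) (qnum q (x + y)))).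
Proof.
move=> tr; set lam := padic_log (1 + t).
have t1 : 1 + t - 1 = t by rewrite addrC addKr.
have lam_lt : abs lam < r.
  apply: (le_lt_trans _ tr); rewrite -[leRHS](congr1 abs t1).
  by apply: (has_sum_log p_prime _).2; rewrite t1.
have term_le (z : K) m : abs z <= 1 ->
    abs (lam ^+ m / m`!%:R * z) <= (abs lam / r) ^+ m.
  move=> z1; rewrite padic_absM; apply: le_trans (exp_term_le_ratio p_prime lam
    m).
  by rewrite ler_piMr ?padic_abs_ge0.
have term_cvg0 := ratio_cvg0 p_prime lam_lt.
have [S ES] := has_sum_ex (abs_cvg0_le (fun m => term_le _ m (qnum_moment_le1
  m)) term_cvg0).
(* It remains to show that the averages of (1+t)^[x+y]_q converge to [S]; this also identifies the
   integral. *)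
rewrite /fermionic_integral (@padic_limE _ _ _ _ S) //.
apply: (tannery (f := fun N m => lam ^+ m / m`!%:R *
    fermionic_avg q (fun y => qnum q (x + y) ^+ m) N) _ term_cvg0 _ _ ES).
- by move=> N m; apply: term_le; apply: qnumX_avg_le1.
- by move=> m; apply: abs_cvgZ; apply: qnumX_avg_cvg.
- move=> N; rewrite /fermionic_avg.
  have lt y : abs (qnum q (x + (y : nat)%:R) * lam) < r.
    apply: le_lt_trans lam_lt; rewrite padic_absM.
    by rewrite ler_piMl ?padic_abs_ge0 ?abs_qnum_nat_le1.
  (* For fixed [N] the average is a finite combination of exponential series, so it can be summed
     term by term. *)
  have exp_sum (y : 'I_(p ^ N)) := has_sumZ ((- q) ^+ y) (has_sum_exp p_prime
    (lt y)).
  have avg_sum := has_sumZ (qnumN q (p ^ N))^-1 (has_sum_sum (index_enum 'I_(p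
    ^ N)) exp_sum).
  under eq_bigr do rewrite mulrC.
  apply: eq_has_sum avg_sum => m; rewrite [RHS]mulrCA; congr (_ * _).
  by rewrite mulr_sumr; apply: eq_bigr => y _; rewrite exprMn; ring.
Qed.

Lemma is_changhee_stirling :
  is_changhee q x (fun n => \sum_(m < n.+1) (stirling1 n m)%:~R * qnum_moment
    m).
Proof.
move=> t tr.
apply: (has_sum_exchange (f := fun n m => (stirling1 n m)%:~R * (t ^+ n /
  n`!%:R)
  * qnum_moment m) _ (ratio_cvg0 p_prime tr) _ _ (has_sum_qnum_moment tr)).
(* The bound must depend on [m] alone: entries with m > n vanish, and for m <= n the natural bound
   (|t|/r)^n is at most (|t|/r)^m. *)
- move=> n m; have [nm|mn] := ltnP n m.
    by rewrite stirling1_small // !mul0r padic_abs0 exprn_ge0 // ratio_ge0.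
  apply: (@le_trans _ _ ((abs t / r) ^+ n)).
    rewrite -[leRHS]mulr1 padic_absM ler_pM ?padic_abs_ge0 ?qnum_moment_le1 //.
    rewrite padic_absM -[leRHS]mul1r ler_pM ?padic_abs_ge0 ?padic_abs_int_le1
      //.
    exact: exp_term_le_ratio.
  apply: ler_wiXn2l => //; first exact: ratio_ge0.
  by rewrite ler_pdivrMr ?exp_radius_gt0 // mul1r ltW.
- move=> n; rewrite mulr_suml (_ : \sum_(_ < _) _ = \sum_(m < n.+1)
    ((stirling1 n m)%:~R * (t ^+ n / n`!%:R) * qnum_moment m)).
    by apply: has_sum_fin => m nm; rewrite stirling1_small // !mul0r.
  by apply: eq_bigr => m _; ring.
- move=> m; rewrite mulrC; under eq_fun do rewrite mulrC.
  by apply: has_sumZ; apply: has_sum_log_pow.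
Qed.

Lemma is_changhee_unique (c d : nat -> K) :
  is_changhee q x c -> is_changhee q x d -> c = d.
Proof.
move=> cS dS; apply/funext => n; apply/eqP; rewrite -subr_eq0.
rewrite -(mulIr_eq0 _ (mulIf (invr_neq0 (padic_fact_neq0 p_prime K n))));
  apply/eqP.
apply: (has_sum_powser_eq0 (d := fun n => (c n - d n) / n`!%:R)) => t tr.
have := has_sumD (cS t tr) (has_sumZ (-1) (dS t tr)).
by rewrite mulN1r subrr; apply: eq_has_sum => k; ring.
Qed.

End GeneratingFunction.

Theorem theorem5 (R : realType) (p : nat) (p_prime : prime p) (p_odd : odd p)
    (K : CpType R p) (q : K) (hq : padic_abs (1 - q) < exp_radius R p)
    (x : K) (hx : padic_int x) (n : nat) :
  changhee q x n =
    \sum_(k < n.+1) \sum_(l < k.+1)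
      'C(k, l)%:R * (stirling1 n k)%:~R * qnum q x ^+ (k - l)
        * padic_pow q (l%:R * x) * carlitz_euler q l.
Proof.
have changheeS := is_changhee_stirling p_prime p_odd hq hx.2.
(* Existence rules out the default zero sequence, and uniqueness identifies the chosen one. *)
rewrite /changhee (xget_unique _ changheeS) => [|c cS]; last first.
  exact: (is_changhee_unique p_prime p_odd) cS changheeS.
apply: eq_bigr => k _; rewrite mulr_sumr; apply: eq_bigr => l _; ring.
Qed.
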